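(* There exists a simple closed smooth curve $\gamma$ in $\mathbb{D}^*=\{z\in\mathbb{C}:0<|z|<1\}$ which is convex (that is, $\kappa_g>0$ along $\gamma$), bounding a domain $V\subset\mathbb{D}=\{z\in\mathbb{C}:|z|<1\}$ which includes $0$, such that: (i) $\oint_{\gamma}\kappa_g\,d(\mathrm{length})>2\pi$, where $\kappa_g$ and length are taken with respect to the complete hyperbolic metric on $\mathbb{D}^*$; (ii) the maximum on $\gamma$ of the function $\lambda_{\mathbb{D}^*}(z)=-\frac{1}{|z|\log|z|}$ is attained at a point $z_{\max}\in\gamma$ at which the normal derivative satisfies $\frac{\partial\lambda_{\mathbb{D}^*}}{\partial\vec{n}}(z_{\max})<0$.
   Context: The complete hyperbolic metric on $\mathbb{D}^*$ is $ds^2_{\mathbb{D}^*}=\lambda_{\mathbb{D}^*}^2\,|dz|^2$ with $\lambda_{\mathbb{D}^*}(z)=-\frac{1}{|z|\log|z|}$. The geodesic curvature $\kappa_g$ of a curve bounding a domain $V$ containing $0$ is signed so that it is positive when the curve bends towards $V$ (for example the circles $|z|=r$, which are horocycles, have $\kappa_g=1$). The vector $\vec{n}$ is the normal to $\gamma$ pointing out of $V$. *)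

(* Defs.v *)
From Stdlib Require Import Reals.
From Coquelicot Require Import Coquelicot.
Open Scope R_scope.

(* The plane is Coquelicot's [C]; [C] is definitionally [R * R]. *)

Definition unit_disc (z : C) : Prop := Cmod z < 1.
Definition punctured_disc (z : C) : Prop := 0 < Cmod z < 1.

Definition lambda (z : C) : R := - (1 / (Cmod z * ln (Cmod z))).

Definition closure (S : C -> Prop) (z : C) : Prop :=
  forall P : C -> Prop, locally z P -> exists w : C, P w /\ S w.

Definition boundary (S : C -> Prop) (z : C) : Prop :=
  closure S z /\ closure (fun w => ~ S w) z.

Definition connected (S : C -> Prop) : Prop :=
  forall A B : C -> Prop, open A -> open B ->
    (forall z, S z -> A z \/ B z) ->
    (forall z, S z -> ~ (A z /\ B z)) ->
    (forall z, S z -> A z) \/ (forall z, S z -> B z).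

Definition planar_domain (V : C -> Prop) : Prop :=
  open V /\ connected V /\ exists z, V z.

Definition velocity (gamma : R -> C) (t : R) : C :=
  (Derive (fun u => Re (gamma u)) t, Derive (fun u => Im (gamma u)) t).

Definition simple_closed_smooth (gamma : R -> C) (T : R) : Prop :=
  0 < T
  /\ (forall (k : nat) (t : R),
        ex_derive_n (fun u => Re (gamma u)) k t
        /\ ex_derive_n (fun u => Im (gamma u)) k t)
  /\ (forall t, velocity gamma t <> RtoC 0)
  /\ (forall t, gamma (t + T) = gamma t)
  /\ (forall s t, 0 <= s < T -> 0 <= t < T -> gamma s = gamma t -> s = t).

Definition bounds (gamma : R -> C) (V : C -> Prop) : Prop :=
  forall z, boundary V z <-> exists t, gamma t = z.

(* [n] is the Euclidean unit normal to [gamma] at [gamma t] that points out of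
   [V]: a short segment through [gamma t] in the direction [n] leaves [V]. *)
Definition outward_normal (V : C -> Prop) (gamma : R -> C) (t : R) (n : C)
  : Prop :=
  Cmod n = 1
  /\ Re n * Re (velocity gamma t) + Im n * Im (velocity gamma t) = 0
  /\ exists eps, 0 < eps /\ forall s, 0 < s < eps ->
       V (gamma t - RtoC s * n)%C /\ ~ V (gamma t + RtoC s * n)%C.

Definition normal_derivative (f : C -> R) (z n : C) : R :=
  Derive (fun s => f (z + RtoC s * n)%C) 0.

(* Below, [rho] is the conformal factor of the metric [rho^2 |dz|^2]. *)

Inductive axis : Set := ax_x | ax_y.

Definition coord (i : axis) (z : C) : R :=
  match i with ax_x => Re z | ax_y => Im z end.

Definition sum_axis (f : axis -> R) : R := f ax_x + f ax_y.

Definition partial (i : axis) (f : C -> R) (z : C) : R :=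
  match i with
  | ax_x => Derive (fun x => f (x, Im z)) (Re z)
  | ax_y => Derive (fun y => f (Re z, y)) (Im z)
  end.

Definition delta (i j : axis) : R :=
  match i, j with ax_x, ax_x | ax_y, ax_y => 1 | _, _ => 0 end.

Definition metric (rho : C -> R) (i j : axis) (z : C) : R :=
  rho z ^ 2 * delta i j.

Definition inv_metric (rho : C -> R) (i j : axis) (z : C) : R :=
  / rho z ^ 2 * delta i j.

Definition inner (rho : C -> R) (z v w : C) : R :=
  sum_axis (fun i => sum_axis (fun j =>
    metric rho i j z * coord i v * coord j w)).

Definition metric_norm (rho : C -> R) (z v : C) : R := sqrt (inner rho z v v).

(* Second kind, upper index [k]. *)
Definition christoffel (rho : C -> R) (k i j : axis) (z : C) : R :=
  / 2 * sum_axis (fun l => inv_metric rho k l z *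
    (partial i (metric rho j l) z + partial j (metric rho i l) z
     - partial l (metric rho i j) z)).

Definition covariant_acceleration (rho : C -> R) (gamma : R -> C) (t : R) : C :=
  let v := velocity gamma t in
  let a := velocity (velocity gamma) t in
  let comp k := coord k a + sum_axis (fun i => sum_axis (fun j =>
    christoffel rho k i j (gamma t) * coord i v * coord j v)) in
  (comp ax_x, comp ax_y).

(* Geodesic curvature at time [t], for an arbitrary regular parametrization.
   [n] is a normal pointing out of the region; with the minus sign the
   curvature is positive when the curve bends towards the region, and the
   circles [|z| = r] have curvature 1 for [rho = lambda]. *)
Definition geodesic_curvature (rho : C -> R) (gamma : R -> C) (n : C) (t : R)
  : R :=
  let z := gamma t in
  - inner rho z (covariant_acceleration rho gamma t) n
    / (metric_norm rho z n * metric_norm rho z (velocity gamma t) ^ 2).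

(* Integrating this over one period gives the integral of [f] against arc
   length. *)
Definition arclength_integrand (rho : C -> R) (gamma : R -> C) (f : R -> R)
  (t : R) : R :=
  f t * metric_norm rho (gamma t) (velocity gamma t).

(* Main.v *)
Require Import Defs.
From Stdlib Require Import Reals Lra ClassicalEpsilon.
From Coquelicot Require Import Coquelicot.
Open Scope R_scope.

(** Let [u = - ln |z|], so that [lambda = exp u / u] decreases in [u] before
    [u = 1] and increases after it.  A curve around [0] along which the mean of
    [1 / u] with respect to the argument exceeds 1 satisfies (i): by Gauss-Bonnet
    on the punctured interior, whose Euler characteristic is 0, the total
    curvature is the hyperbolic area, that is, the integral of [1 / u] against
    the argument.  For (ii) the largest value of [lambda] has to be reached where
    [u > 1], on the side of the cusp, because there [lambda] decreases outwards.
    On the horocycle [|z| = exp (-1)] equality holds in (i) and the gradient of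
    [lambda] vanishes.  Moving it off centre, so that [u] varies by [a] about its
    mean, raises the mean of [1 / u] by about [a^2 / 2], by convexity.  As [lambda]
    grows more slowly on the side [u > 1], (ii) asks for a compensating increase
    of the mean of [u], but only by about [a^2 / 3].

    The curve used here is the Euclidean circle with diameter [-1/4, 1/2].
    Along it [|z|] runs over [[1/4, 1/2]], and since [u (1/4) = 2 * u (1/2)], the
    values of [lambda] at the two ends of the diameter are equal, namely
    [2 / ln 2].  Concavity of [ln] makes this the maximum ([lambda_le_inner]),
    and [-1/4] is a maximum point with [u = 2 * ln 2 > 1].  As the curve is a
    Euclidean circle, its topology is elementary and all data at the point with
    angle [t] are functions of [x = cos t].

    The curvature of a curve in the metric [rho^2 |dz|^2] is its Euclidean
    curvature plus the outward derivative of [ln rho], divided by [rho]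
    ([conformal_geodesic_curvature]).  Hence the integrand of (i) is
    [curvature_density (cos t)], an explicit function containing one logarithm.
    It is bounded below on [[-1, 1]] by a positive cubic polynomial in [x]
    ([minorant_le], [minorant_pos]).  Positivity gives convexity, and the mean of
    the cubic over the circle is 1.001 ([RInt_minorant]), which gives (i). *)

(** * Euclidean circles centred on the real axis *)

Definition circle (c rho t : R) : C := (c + rho * cos t, rho * sin t).

Definition open_disc (c rho : R) (z : C) : Prop :=
  (Re z - c) ^ 2 + Im z ^ 2 < rho ^ 2.

(** The span of [1], [cos] and [sin] is stable under differentiation, so every
    derivative of such a function is again in it and hence differentiable. *)
Lemma trig_Derive_n (a b c : R) (k : nat) :
  exists a' b' c', forall t,
    Derive_n (fun u => a + b * cos u + c * sin u) k t
    = a' + b' * cos t + c' * sin t.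
Proof.
  induction k as [|k (a' & b' & c' & IH)].
  - exists a, b, c. reflexivity.
  - exists 0, c', (- b'). intros t. simpl.
    rewrite (Derive_ext _ _ _ IH). apply is_derive_unique.
    auto_derive; [easy | ring].
Qed.

Lemma trig_smooth (a b c : R) (k : nat) (t : R) :
  ex_derive_n (fun u => a + b * cos u + c * sin u) k t.
Proof.
  destruct k as [|k]; simpl; [easy |].
  destruct (trig_Derive_n a b c k) as (a' & b' & c' & E).
  apply ex_derive_ext with (fun u => a' + b' * cos u + c' * sin u).
  - intros u. symmetry. apply E.
  - auto_derive; easy.
Qed.

Lemma circle_velocity (c rho t : R) :
  velocity (circle c rho) t = (- rho * sin t, rho * cos t).
Proof.
  unfold velocity, circle. simpl. f_equal; apply is_derive_unique;
    auto_derive; try easy; ring.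
Qed.

Lemma circle_acceleration (c rho t : R) :
  velocity (velocity (circle c rho)) t = (- rho * cos t, - rho * sin t).
Proof.
  unfold velocity at 1. f_equal; apply is_derive_unique.
  - apply is_derive_ext with (fun u => - rho * sin u).
    + intros u. now rewrite circle_velocity.
    + auto_derive; [easy | ring].
  - apply is_derive_ext with (fun u => rho * cos u).
    + intros u. now rewrite circle_velocity.
    + auto_derive; [easy | ring].
Qed.

Lemma cos_eq_1_small (d : R) : - (2 * PI) < d < 2 * PI -> cos d = 1 -> d = 0.
Proof.
  intros Hd E.
  replace d with (2 * (d / 2)) in E by field. rewrite cos_2a_sin in E.
  assert (S : sin (d / 2) = 0) by nra.
  destruct (Rtotal_order d 0) as [H | [H | H]]; [| easy |].
  - assert (0 < sin (- (d / 2))) by (apply sin_gt_0; lra).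
    rewrite sin_neg in *. lra.
  - assert (0 < sin (d / 2)) by (apply sin_gt_0; lra). lra.
Qed.

Lemma cos_sin_inj (s t : R) :
  0 <= s < 2 * PI -> 0 <= t < 2 * PI ->
  cos s = cos t -> sin s = sin t -> s = t.
Proof.
  intros Hs Ht Ec Es.
  enough (s - t = 0) by lra.
  apply cos_eq_1_small; [lra |].
  rewrite cos_minus, Ec, Es.
  pose proof (sin2_cos2 t) as H. unfold Rsqr in H. lra.
Qed.

Lemma circle_simple_closed_smooth (c rho : R) :
  0 < rho -> simple_closed_smooth (circle c rho) (2 * PI).
Proof.
  intros Hr. repeat split.
  - pose proof PI_RGT_0. lra.
  - apply (ex_derive_n_ext (fun u => c + rho * cos u + 0 * sin u)).
    + intros u. unfold circle. simpl. ring.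
    + apply trig_smooth.
  - apply (ex_derive_n_ext (fun u => 0 + 0 * cos u + rho * sin u)).
    + intros u. unfold circle. simpl. ring.
    + apply trig_smooth.
  - intros t. rewrite circle_velocity. intros E.
    injection E as E1 E2.
    pose proof (sin2_cos2 t) as H. unfold Rsqr in H.
    assert (sin t = 0) by nra. assert (cos t = 0) by nra. nra.
  - intros t. unfold circle. rewrite cos_plus, sin_plus, cos_2PI, sin_2PI.
    f_equal; ring.
  - intros s t Hs Ht E. injection E as E1 E2.
    apply cos_sin_inj; nra.
Qed.

Lemma unit_circle_param (x y : R) :
  x ^ 2 + y ^ 2 = 1 -> exists t, x = cos t /\ y = sin t.
Proof.
  intros H. assert (Hx : -1 <= x <= 1) by nra.
  pose proof (cos_acos x Hx) as Ec.
  pose proof (acos_bound x) as Hb.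
  assert (Hs : 0 <= sin (acos x)) by (apply sin_ge_0; lra).
  pose proof (sin2_cos2 (acos x)) as H2. unfold Rsqr in H2. rewrite Ec in H2.
  destruct (Rle_dec 0 y).
  - exists (acos x). split; [easy | nra].
  - exists (- acos x). rewrite cos_neg, sin_neg. split; [easy | nra].
Qed.

Lemma continuous_dist2 (c : R) (z : C) :
  continuous (fun z : C => (Re z - c) ^ 2 + Im z ^ 2) z.
Proof.
  assert (Hre : continuous (fun z : C => Re z) z) by apply continuous_fst.
  assert (Him : continuous (fun z : C => Im z) z) by apply continuous_snd.
  apply (continuous_plus (fun z : C => (Re z - c) ^ 2) (fun z : C => Im z ^ 2)).
  - apply (continuous_comp (fun z : C => Re z) (fun x => (x - c) ^ 2)); [easy |].
    apply (ex_derive_continuous (fun x => (x - c) ^ 2)). auto_derive; easy.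
  - apply (continuous_comp (fun z : C => Im z) (fun x => x ^ 2)); [easy |].
    apply (ex_derive_continuous (fun x => x ^ 2)). auto_derive; easy.
Qed.

Lemma disc_open (c rho : R) : open (open_disc c rho).
Proof.
  apply (open_comp (fun z : C => (Re z - c) ^ 2 + Im z ^ 2)
           (fun d => d < rho ^ 2)).
  - intros z _. apply continuous_dist2.
  - apply open_lt.
Qed.

Lemma disc_exterior_open (c rho : R) :
  open (fun z : C => rho ^ 2 < (Re z - c) ^ 2 + Im z ^ 2).
Proof.
  apply (open_comp (fun z : C => (Re z - c) ^ 2 + Im z ^ 2)
           (fun d => rho ^ 2 < d)).
  - intros z _. apply continuous_dist2.
  - apply open_gt.
Qed.

Lemma circle_plus_normal (c rho s t : R) :
  (circle c rho t + RtoC s * (cos t, sin t))%C = circle c (rho + s) t.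
Proof. unfold circle, RtoC, Cplus, Cmult. simpl. f_equal; ring. Qed.

Lemma circle_minus_normal (c rho s t : R) :
  (circle c rho t - RtoC s * (cos t, sin t))%C = circle c (rho - s) t.
Proof. unfold circle, RtoC, Cminus, Copp, Cplus, Cmult. simpl. f_equal; ring. Qed.

Lemma disc_circle (c rho r t : R) : open_disc c rho (circle c r t) <-> r ^ 2 < rho ^ 2.
Proof.
  unfold open_disc, circle. simpl Re. simpl Im.
  replace ((c + r * cos t - c) ^ 2 + (r * sin t) ^ 2) with (r ^ 2); [easy |].
  pose proof (sin2_cos2 t) as H. unfold Rsqr in H.
  transitivity (r ^ 2 * (sin t * sin t + cos t * cos t)); [rewrite H |]; ring.
Qed.

Lemma circle_outward_normal (c rho t : R) :
  0 < rho -> outward_normal (open_disc c rho) (circle c rho) t (cos t, sin t).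
Proof.
  intros Hr. split; [| split].
  - unfold Cmod. simpl. pose proof (sin2_cos2 t) as H. unfold Rsqr in H.
    replace (cos t * (cos t * 1) + sin t * (sin t * 1)) with 1 by lra.
    apply sqrt_1.
  - rewrite circle_velocity. simpl. ring.
  - exists rho. split; [easy |]. intros s Hs.
    rewrite circle_plus_normal, circle_minus_normal, 2!disc_circle.
    split; nra.
Qed.

(** A boundary point can be neither in the open disc nor in the open exterior.
    Conversely a point of the circle is outside the disc and is the limit of
    points of smaller concentric circles. *)
Lemma circle_bounds_disc (c rho : R) :
  0 < rho -> bounds (circle c rho) (open_disc c rho).
Proof.
  intros Hr z. split.
  - intros [Hin Hout].
    destruct (Rtotal_order ((Re z - c) ^ 2 + Im z ^ 2) (rho ^ 2))
      as [H | [H | H]].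
    + destruct (Hout _ (disc_open c rho z H)) as (w & H1 & H2). easy.
    + destruct (unit_circle_param ((Re z - c) / rho) (Im z / rho))
        as (t & Ex & Ey).
      { field_simplify_eq; [| lra]. rewrite <- H. ring. }
      exists t. unfold circle. rewrite <- Ex, <- Ey.
      destruct z as [x y]. simpl. f_equal; field; lra.
    + destruct (Hin _ (disc_exterior_open c rho z H)) as (w & H1 & H2).
      unfold open_disc in H2. lra.
  - intros [t <-]. split.
    + intros P [eps HP].
      set (s := Rmin eps rho / 2).
      assert (Hs : 0 < s /\ s < eps /\ s < rho).
      { pose proof (cond_pos eps). unfold s.
        pose proof (Rmin_l eps rho). pose proof (Rmin_r eps rho).
        pose proof (Rmin_pos eps rho). lra. }
      exists (circle c (rho - s) t). split.
      * apply HP. pose proof (COS_bound t). pose proof (SIN_bound t).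
        split; simpl; unfold ball; simpl;
          unfold AbsRing_ball, abs, minus, plus, opp; simpl;
          apply Rabs_def1; nra.
      * apply disc_circle. nra.
    + intros P HP. exists (circle c rho t). split.
      * now apply locally_singleton.
      * rewrite disc_circle. lra.
Qed.

(** The retraction of the line onto [[0, 1]]; it turns a segment into a path
    defined and continuous on all of [R], as the intermediate value theorem
    below wants. *)
Definition clamp (t : R) : R := (1 + Rabs t - Rabs (t - 1)) / 2.

Lemma continuous_clamp (t : R) : continuous clamp t.
Proof.
  unfold clamp.
  apply (continuous_ext
    (fun t => scal (/ 2) (plus (plus 1 (Rabs t)) (opp (Rabs (t - 1)))))).
  { intros u. unfold scal, plus, opp; simpl; unfold mult; simpl. field. }
  apply (continuous_scal_r (/ 2) (fun t => plus (plus 1 (Rabs t)) (opp (Rabs (t - 1))))).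
  apply (continuous_plus (fun t => plus 1 (Rabs t)) (fun t => opp (Rabs (t - 1)))).
  - apply (continuous_plus (fun _ => 1) Rabs).
    + apply continuous_const.
    + apply continuous_Rabs.
  - apply (continuous_opp (fun t => Rabs (t - 1))).
    apply (continuous_comp (fun t => t - 1) Rabs).
    + apply (ex_derive_continuous (fun t => t - 1)). auto_derive; easy.
    + apply continuous_Rabs.
Qed.

Lemma clamp_range (t : R) : 0 <= clamp t <= 1.
Proof. unfold clamp, Rabs. destruct (Rcase_abs t), (Rcase_abs (t - 1)); lra. Qed.

Definition segment (p q : C) (t : R) : C :=
  (Re p + clamp t * (Re q - Re p), Im p + clamp t * (Im q - Im p)).

Lemma continuous_segment (p q : C) (t : R) : continuous (segment p q) t.
Proof.
  assert (H : forall a b, continuous (fun u => a + clamp u * b) t).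
  { intros a b. apply (continuous_comp clamp (fun x => a + x * b)).
    - apply continuous_clamp.
    - apply (ex_derive_continuous (fun x => a + x * b)). auto_derive; easy. }
  apply (continuous_comp_2 (fun u => Re p + clamp u * (Re q - Re p))
           (fun u => Im p + clamp u * (Im q - Im p)) (fun x y => (x, y))); try apply H.
  apply (continuous_ext (fun z : R * R => z)); [now intros [] |].
  apply continuous_id.
Qed.

Definition convex (S : C -> Prop) : Prop :=
  forall p q t, S p -> S q -> 0 <= t <= 1 ->
    S (Re p + t * (Re q - Re p), Im p + t * (Im q - Im p)).

(** If [A] and [B] separated [S], then along a segment from a point of [B] to a
    point of [A] the indicator function of [A] would be continuous, being locally
    constant, and would jump from 0 to 1 without the value 1/2. *)
Lemma convex_connected (S : C -> Prop) : convex S -> connected S.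
Proof.
  intros HS A B HA HB Hcov Hdis.
  destruct (excluded_middle_informative (forall z, S z -> A z)) as [|NA];
    [now left | right].
  intros q Hq. destruct (Hcov q Hq) as [HAq | HBq]; [exfalso | easy].
  apply NA. intros p Hp. destruct (Hcov p Hp) as [HAp | HBp]; [easy | exfalso].
  assert (Hseg : forall t, S (segment p q t)).
  { intros t. apply HS; try easy. apply clamp_range. }
  set (f t := if excluded_middle_informative (A (segment p q t))
              then 1 else 0).
  assert (Hf : continuity f).
  { intros t. apply continuity_pt_filterlim.
    destruct (Hcov _ (Hseg t)) as [H | H].
    - apply (continuous_ext_loc _ (fun _ => 1)); [| apply continuous_const].
      apply (filter_imp (fun u => A (segment p q u)));
        [| exact (continuous_segment p q t _ (HA _ H))].
      intros u Hu. unfold f.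
      destruct (excluded_middle_informative (A (segment p q u))); easy.
    - apply (continuous_ext_loc _ (fun _ => 0)); [| apply continuous_const].
      apply (filter_imp (fun u => B (segment p q u)));
        [| exact (continuous_segment p q t _ (HB _ H))].
      intros u Hu. unfold f.
      destruct (excluded_middle_informative (A (segment p q u))) as [K|]; [| easy].
      destruct (Hdis _ (Hseg u)). easy. }
  assert (E0 : segment p q 0 = p).
  { unfold segment, clamp. rewrite Rabs_R0, Rabs_left by lra.
    destruct p, q. simpl. f_equal; field. }
  assert (E1 : segment p q 1 = q).
  { unfold segment, clamp. rewrite Rminus_diag, Rabs_R0, Rabs_R1.
    destruct p, q. simpl. f_equal; field. }
  assert (F0 : f 0 = 0).
  { unfold f. rewrite E0.
    destruct (excluded_middle_informative (A p)); [| easy].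
    destruct (Hdis p Hp). easy. }
  assert (F1 : f 1 = 1).
  { unfold f. rewrite E1.
    destruct (excluded_middle_informative (A q)); easy. }
  destruct (IVT_gen f 0 1 (1 / 2) Hf) as (t & _ & Ht).
  { rewrite F0, F1, Rmin_left, Rmax_right; lra. }
  unfold f in Ht.
  destruct (excluded_middle_informative (A (segment p q t))); lra.
Qed.

Lemma disc_convex (c rho : R) : convex (open_disc c rho).
Proof.
  intros [p1 p2] [q1 q2] t Hp Hq Ht. unfold open_disc in *. simpl Re in *.
  simpl Im in *.
  set (a := (p1 - c) ^ 2 + p2 ^ 2) in *. set (b := (q1 - c) ^ 2 + q2 ^ 2) in *.
  replace ((p1 + t * (q1 - p1) - c) ^ 2 + (p2 + t * (q2 - p2)) ^ 2)
    with ((1 - t) * a + t * b - t * (1 - t) * ((p1 - q1) ^ 2 + (p2 - q2) ^ 2))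
    by (unfold a, b; ring).
  assert (0 <= t * (1 - t) * ((p1 - q1) ^ 2 + (p2 - q2) ^ 2)).
  { apply Rmult_le_pos; [nra |].
    apply Rplus_le_le_0_compat; apply pow2_ge_0. }
  destruct (Rle_dec a b).
  - assert (0 <= (1 - t) * (b - a)) by (apply Rmult_le_pos; lra). lra.
  - assert (0 <= t * (a - b)) by (apply Rmult_le_pos; lra). lra.
Qed.

Lemma disc_planar_domain (c rho : R) : 0 < rho -> planar_domain (open_disc c rho).
Proof.
  intros Hr. split; [apply disc_open | split].
  - apply convex_connected, disc_convex.
  - exists (c, 0). unfold open_disc. simpl. nra.
Qed.

(** * Geodesic curvature of a conformal metric *)

Definition dot (v w : C) : R := Re v * Re w + Im v * Im w.

Lemma is_derive_sqr_scal (F : R -> R) (s d k : R) :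
  is_derive F s d -> is_derive (fun x => F x ^ 2 * k) s (2 * F s * d * k).
Proof.
  intros HF. auto_derive.
  - now exists d.
  - change (fun x => F x) with F. rewrite (is_derive_unique _ _ _ HF). ring.
Qed.

(** The Christoffel terms contribute [2 (grad rho . v) v / rho - |v|^2 grad rho / rho]
    to the acceleration; pairing with a normal kills the first summand. *)
Lemma conformal_geodesic_curvature (rho : C -> R) (gamma : R -> C) (n : C)
    (t gx gy : R) :
  0 < rho (gamma t) ->
  is_derive (fun x => rho (x, Im (gamma t))) (Re (gamma t)) gx ->
  is_derive (fun y => rho (Re (gamma t), y)) (Im (gamma t)) gy ->
  velocity gamma t <> RtoC 0 ->
  dot n n = 1 -> dot n (velocity gamma t) = 0 ->
  geodesic_curvature rho gamma n t
  = (dot (gx, gy) n / rho (gamma t)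
     - dot (velocity (velocity gamma) t) n
       / dot (velocity gamma t) (velocity gamma t)) / rho (gamma t).
Proof.
  intros Hrho Hx Hy Hv Hn Hnv.
  assert (Px : forall i j, partial ax_x (metric rho i j) (gamma t)
                 = 2 * rho (gamma t) * gx * delta i j).
  { intros i j. simpl. apply is_derive_unique. unfold metric.
    assert (E : rho (Re (gamma t), Im (gamma t)) = rho (gamma t))
      by now destruct (gamma t).
    rewrite <- E. now apply (is_derive_sqr_scal (fun x => rho (x, Im (gamma t)))). }
  assert (Py : forall i j, partial ax_y (metric rho i j) (gamma t)
                 = 2 * rho (gamma t) * gy * delta i j).
  { intros i j. simpl. apply is_derive_unique. unfold metric.
    assert (E : rho (Re (gamma t), Im (gamma t)) = rho (gamma t))
      by now destruct (gamma t).
    rewrite <- E. now apply (is_derive_sqr_scal (fun y => rho (Re (gamma t), y))). }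
  assert (N : forall w, inner rho (gamma t) w w
                = rho (gamma t) ^ 2 * dot w w).
  { intros w. unfold inner, sum_axis, metric, dot. simpl. ring. }
  assert (Vpos : 0 < dot (velocity gamma t) (velocity gamma t)).
  { unfold dot. destruct (velocity gamma t) as [a b]. simpl.
    destruct (Req_dec a 0) as [-> |]; [| nra].
    destruct (Req_dec b 0) as [-> |]; [now destruct Hv | nra]. }
  unfold geodesic_curvature.
  unfold metric_norm. rewrite pow2_sqrt, 2!N, Hn
    by (rewrite N; apply Rmult_le_pos; nra).
  rewrite Rmult_1_r, sqrt_pow2 by lra.
  unfold inner, covariant_acceleration, christoffel, sum_axis.
  rewrite ?Px, ?Py.
  destruct n as [n1 n2]. unfold dot, metric, inv_metric in *.
  destruct (velocity (velocity gamma) t) as [a1 a2].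
  destruct (velocity gamma t) as [v1 v2]. simpl in *.
  field_simplify_eq; [| lra].
  (* The two sides differ by a multiple of [n . v = 0]. *)
  pose proof (f_equal (Rmult (-4 * rho (gamma t) ^ 3 * (gx * v1 + gy * v2))) Hnv).
  lra.
Qed.

(** With [r = |z|] the gradient of [lambda] is [lambda^2 (1 + ln r) z / r].  The
    form along a path covers both the partial derivatives needed for the
    Christoffel symbols and the normal derivative. *)
Lemma is_derive_lambda_comp (f g : R -> R) (s df dg : R) :
  is_derive f s df -> is_derive g s dg -> punctured_disc (f s, g s) ->
  is_derive (fun u => lambda (f u, g u)) s
    (lambda (f s, g s) ^ 2 * (1 + ln (Cmod (f s, g s)))
     * (f s * df + g s * dg) / Cmod (f s, g s)).
Proof.
  intros Hf Hg [H0 H1]. unfold lambda, Cmod in *. simpl in *.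
  set (q := f s * (f s * 1) + g s * (g s * 1)) in *.
  assert (Hq : 0 < q).
  { destruct (Rle_dec q 0) as [K|]; [| lra]. rewrite sqrt_neg_0 in H0 by easy. lra. }
  assert (L : ln (sqrt q) < 0) by (rewrite <- ln_1; now apply ln_increasing).
  auto_derive; fold q.
  - repeat split; try easy; try (now exists df); try (now exists dg). nra.
  - change (fun x => f x) with f. change (fun x => g x) with g.
    rewrite (is_derive_unique _ _ _ Hf), (is_derive_unique _ _ _ Hg).
    field. lra.
Qed.

Lemma lambda_pos (z : C) : punctured_disc z -> 0 < lambda z.
Proof.
  intros [H0 H1]. unfold lambda.
  assert (ln (Cmod z) < 0) by (rewrite <- ln_1; now apply ln_increasing).
  replace (- (1 / (Cmod z * ln (Cmod z)))) with (/ (Cmod z * - ln (Cmod z)))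
    by (field; lra).
  apply Rinv_0_lt_compat, Rmult_lt_0_compat; lra.
Qed.

(** * A polynomial minorant of the curvature density *)

Lemma nonneg_of_derive_sign (f df : R -> R) (a b x : R) :
  a <= 0 <= b -> a <= x <= b -> f 0 = 0 ->
  (forall v, a <= v <= b -> is_derive f v (df v)) ->
  (forall v, a <= v <= 0 -> df v <= 0) ->
  (forall v, 0 <= v <= b -> 0 <= df v) -> 0 <= f x.
Proof.
  intros Hab Hx F0 Hd Hneg Hpos.
  destruct (MVT_gen f 0 x df) as (c & Hc & E).
  - intros v Hv. apply Hd. revert Hv. unfold Rmin, Rmax.
    destruct (Rle_dec 0 x); lra.
  - intros v Hv. apply continuity_pt_filterlim.
    apply (ex_derive_continuous f). exists (df v). apply Hd.
    revert Hv. unfold Rmin, Rmax. destruct (Rle_dec 0 x); lra.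
  - revert Hc E. unfold Rmin, Rmax. destruct (Rle_dec 0 x); intros Hc E.
    + specialize (Hpos c). nra.
    + specialize (Hneg c). nra.
Qed.

(** The difference of the two sides vanishes at 0 and its derivative is [v] times
    a nonnegative factor.  The term [v^2 / 24] is there for negative [v]: 1/24 is
    the least coefficient for which that factor remains nonnegative at
    [v = -1/3]. *)
Lemma artanh_lower (v : R) : - (1 / 3) <= v <= 1 / 3 ->
  2 * v - v ^ 2 / 24 + 2 / 3 * v ^ 3 <= ln (1 + v) - ln (1 - v).
Proof.
  intros Hv.
  enough (0 <= ln (1 + v) - ln (1 - v)
               - (2 * v - v ^ 2 / 24 + 2 / 3 * v ^ 3)) by lra.
  assert (Hd : forall u, - (1 / 3) <= u <= 1 / 3 ->
    is_derive (fun u => ln (1 + u) - ln (1 - u)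
               - (2 * u - u ^ 2 / 24 + 2 / 3 * u ^ 3)) u
      (u * (1 / 12 + 2 * u ^ 3 / (1 - u ^ 2)))).
  { intros u Hu. auto_derive; [lra |]. field. nra. }
  assert (Hf : forall u, - (1 / 3) <= u <= 1 / 3 ->
    0 <= 1 / 12 + 2 * u ^ 3 / (1 - u ^ 2)).
  { intros u Hu.
    replace (1 / 12 + 2 * u ^ 3 / (1 - u ^ 2))
      with ((1 + 3 * u) * (1 - 3 * u + 8 * u ^ 2) / (12 * (1 - u ^ 2)))
      by (field; nra).
    apply Rdiv_le_0_compat; [apply Rmult_le_pos |]; nra. }
  apply (nonneg_of_derive_sign _ _ (- (1 / 3)) (1 / 3) v) with (4 := Hd);
    try lra.
  - rewrite Rplus_0_r, Rminus_0_r. lra.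
  - intros u Hu. assert (0 <= 1 / 12 + 2 * u ^ 3 / (1 - u ^ 2)) by (apply Hf; lra). nra.
  - intros u Hu. apply Rmult_le_pos; [lra | apply Hf; lra].
Qed.

(** Against the density of [cos t] the Lobatto rule with nodes -1, 0, 1 and
    weights 1/4, 1/2, 1/4 is exact on cubics.  The cubic that meets the curvature
    density at -1 and 1 and is tangent to it at 0 lies below it on [[-1, 1]] and
    has mean about 1.013; the coefficients here come from rounding it down while
    keeping the mean [1056/1000 - 11/200] above 1. *)
Definition minorant (x : R) : R :=
  1056 / 1000 + 3 / 10 * x - 11 / 100 * x ^ 2 + 72 / 1000 * x ^ 3.

(** [minorant_le] after the substitution [x = (9 v - 1) / (3 (1 - v))], with
    [- ln |z|^2] replaced by its bound [B].  Cleared of denominators, it says that a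
    polynomial [D] of degree 7 is nonnegative on [[-1/3, 1/3]]. *)
Lemma minorant_rational (v B : R) :
  - (1 / 3) <= v <= 1 / 3 ->
  B = 2088 / 1000 - (2 * v - v ^ 2 / 24 + 2 / 3 * v ^ 3) ->
  0 < B ->
  minorant ((9 * v - 1) / (3 * (1 - v))) <= (v + 2 / B) / (1 + v).
Proof.
  intros Hv HB Bpos.
  set (D := 27 * (1 - v) ^ 3
    * ((v * B + 2) - minorant ((9 * v - 1) / (3 * (1 - v))) * B * (1 + v))).
  assert (HD : 0 <= 500000 * D).
  (* On each half of the interval all Bernstein coefficients of [D] are
     positive; the factor 500000 makes them integers. *)
  { destruct (Rle_dec 0 v) as [H | H].
    - set (w := 1 - 3 * v).
      replace (500000 * D) with
        (471960 * w ^ 7 + 5698488 * v * w ^ 6 + 26415257 * v ^ 2 * w ^ 5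
         + 95767081 * v ^ 3 * w ^ 4 + 365822998 * v ^ 4 * w ^ 3
         + 846131708 * v ^ 5 * w ^ 2 + 734785464 * v ^ 6 * w
         + 40146624 * v ^ 7)
        by (unfold D, minorant, w; rewrite HB; field; lra).
      assert (0 <= w) by (unfold w; lra).
      repeat apply Rplus_le_le_0_compat;
        repeat apply Rmult_le_pos; try (apply pow_le); lra.
    - set (u := - v). set (w := 1 - 3 * u).
      replace (500000 * D) with
        (471960 * w ^ 7 + 14123832 * u * w ^ 6 + 178071449 * u ^ 2 * w ^ 5
         + 1187524709 * u ^ 3 * w ^ 4 + 4367543014 * u ^ 4 * w ^ 3
         + 8400521320 * u ^ 5 * w ^ 2 + 6787900320 * u ^ 6 * w
         + 466432128 * u ^ 7)
        by (unfold D, minorant, w, u; rewrite HB; field; lra).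
      assert (0 <= u) by (unfold u; lra).
      assert (0 <= w) by (unfold w, u; lra).
      repeat apply Rplus_le_le_0_compat;
        repeat apply Rmult_le_pos; try (apply pow_le); lra. }
  enough (0 <= (v + 2 / B) / (1 + v)
               - minorant ((9 * v - 1) / (3 * (1 - v)))) by lra.
  replace ((v + 2 / B) / (1 + v) - minorant ((9 * v - 1) / (3 * (1 - v))))
    with (D / (27 * (1 - v) ^ 3 * (B * (1 + v))))
    by (unfold D; field; lra).
  apply Rdiv_le_0_compat; [lra |].
  repeat apply Rmult_lt_0_compat; try apply pow_lt; lra.
Qed.

(** The geodesic curvature times the length element at the point with angle [t],
    as a function of [x = cos t].  Here [(5 + 3 x) / 32] is [|z|^2], and
    [(9 + 3 x) / (10 + 6 x)] is the derivative of [arg z] in [t]. *)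
Definition curvature_density (x : R) : R :=
  1 - (1 + 2 / ln ((5 + 3 * x) / 32)) * ((9 + 3 * x) / (10 + 6 * x)).

(** [artanh_lower] at the endpoint [-1/3], where the quotient of [1 + v] by
    [1 - v] is 1/2. *)
Lemma ln_2_upper : 3 * ln 2 <= 2088 / 1000.
Proof.
  pose proof (artanh_lower (- (1 / 3))) as H.
  replace (1 + - (1 / 3)) with (2 / 3) in H by field.
  replace (1 - - (1 / 3)) with (2 * (2 / 3)) in H by field.
  rewrite (ln_mult 2 (2 / 3)) in H by lra. lra.
Qed.

(** The Moebius substitution for [v] turns the argument of the logarithm,
    [(5 + 3 x) / 32], into [(1 + v) / (8 (1 - v))] and the derivative of the
    argument into [1 / (1 + v)], so that [artanh_lower] applies. *)
Lemma minorant_le (x : R) : -1 <= x <= 1 -> minorant x <= curvature_density x.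
Proof.
  intros Hx. set (v := (1 + 3 * x) / (9 + 3 * x)).
  assert (Hv : - (1 / 3) <= v <= 1 / 3).
  { unfold v. split.
    - apply Rle_div_r; lra.
    - apply Rle_div_l; lra. }
  assert (E1 : x = (9 * v - 1) / (3 * (1 - v))) by (unfold v; field; lra).
  set (B := 2088 / 1000 - (2 * v - v ^ 2 / 24 + 2 / 3 * v ^ 3)).
  assert (HL : - ln ((5 + 3 * x) / 32) <= B).
  { replace ((5 + 3 * x) / 32) with ((1 + v) / (2 * 2 * 2 * (1 - v)))
      by (unfold v; field; lra).
    rewrite ln_div, !ln_mult by lra.
    pose proof (artanh_lower v Hv). pose proof ln_2_upper. unfold B. lra. }
  set (L := - ln ((5 + 3 * x) / 32)) in *.
  assert (Lpos : 0 < L).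
  { unfold L. enough (ln ((5 + 3 * x) / 32) < 0) by lra.
    rewrite <- ln_1. apply ln_increasing; lra. }
  apply Rle_trans with ((v + 2 / B) / (1 + v)).
  - rewrite E1 at 1. apply minorant_rational; [easy | reflexivity | lra].
  - unfold curvature_density.
    replace (ln ((5 + 3 * x) / 32)) with (- L) by (unfold L; ring).
    replace (1 - (1 + 2 / - L) * ((9 + 3 * x) / (10 + 6 * x)))
      with ((v + 2 / L) / (1 + v)) by (unfold v; field; lra).
    apply Rmult_le_compat_r.
    + left. apply Rinv_0_lt_compat. lra.
    + apply Rplus_le_compat_l, Rmult_le_compat_l; [lra |].
      now apply Rinv_le_contravar.
Qed.

Lemma minorant_pos (x : R) : -1 <= x <= 1 -> 0 < minorant x.
Proof. intros Hx. unfold minorant. nra. Qed.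

Lemma RInt_minorant :
  is_RInt (fun t => minorant (cos t)) 0 (2 * PI) (2 * PI * (1001 / 1000)).
Proof.
  set (F t := 1001 / 1000 * t + 3 / 10 * sin t - 11 / 200 * (sin t * cos t)
              + 72 / 1000 * (sin t - sin t ^ 3 / 3)).
  replace (2 * PI * (1001 / 1000)) with (minus (F (2 * PI)) (F 0)).
  2: { unfold F, minus, plus, opp. simpl.
       rewrite sin_2PI, sin_0, cos_2PI, cos_0. field. }
  apply (is_RInt_derive F (fun t => minorant (cos t))).
  - intros t _. unfold F. auto_derive; [easy |].
    unfold minorant. pose proof (sin2_cos2 t) as H. unfold Rsqr in H.
    replace (cos t ^ 3) with (cos t * (1 - sin t * sin t)) by (rewrite <- H; ring).
    transitivity (1001 / 1000 + 3 / 10 * cos t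
       - 11 / 200 * (cos t * cos t - sin t * sin t)
       + 72 / 1000 * (cos t - cos t * (sin t * sin t))); [field |].
    replace (sin t * sin t) with (1 - cos t * cos t) by lra. field.
  - intros t _. apply (ex_derive_continuous (fun t => minorant (cos t))).
    unfold minorant. auto_derive; easy.
Qed.

Lemma continuous_curvature_density (t : R) :
  continuous (fun t => curvature_density (cos t)) t.
Proof.
  apply (ex_derive_continuous (fun t => curvature_density (cos t))).
  pose proof (COS_bound t) as Hc.
  assert (ln ((5 + 3 * cos t) / 32) < 0).
  { rewrite <- ln_1. apply ln_increasing; lra. }
  unfold curvature_density. auto_derive. unfold Rdiv in *.
  repeat split; lra.
Qed.

Lemma curvature_density_integral :
  ex_RInt (fun t => curvature_density (cos t)) 0 (2 * PI)
  /\ RInt (fun t => curvature_density (cos t)) 0 (2 * PI) > 2 * PI.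
Proof.
  pose proof PI_RGT_0.
  assert (E : ex_RInt (fun t => curvature_density (cos t)) 0 (2 * PI)).
  { apply (ex_RInt_continuous (fun t => curvature_density (cos t))).
    intros t _. apply continuous_curvature_density. }
  split; [easy |].
  apply Rlt_le_trans with (2 * PI * (1001 / 1000)); [lra |].
  rewrite <- (is_RInt_unique _ _ _ _ RInt_minorant).
  apply RInt_le; [lra | | easy |].
  - now exists (2 * PI * (1001 / 1000)); apply RInt_minorant.
  - intros t _. apply minorant_le, COS_bound.
Qed.

(** * The circle with diameter from -1/4 to 1/2 *)

Definition gamma0 : R -> C := circle (1 / 8) (3 / 8).

Lemma Cmod_gamma0_sqr (t : R) : Cmod (gamma0 t) ^ 2 = (5 + 3 * cos t) / 32.
Proof.
  unfold Cmod. rewrite pow2_sqrt by (apply Rplus_le_le_0_compat; apply pow2_ge_0).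
  unfold gamma0, circle. simpl fst. simpl snd.
  pose proof (sin2_cos2 t) as H. unfold Rsqr in H.
  transitivity (1 / 64 + 3 / 32 * cos t + 9 / 64 * (sin t * sin t + cos t * cos t));
    [field | rewrite H; field].
Qed.

Lemma Cmod_gamma0_bounds (t : R) : 1 / 4 <= Cmod (gamma0 t) <= 1 / 2.
Proof.
  pose proof (Cmod_gamma0_sqr t). pose proof (Cmod_ge_0 (gamma0 t)).
  pose proof (COS_bound t). split; nra.
Qed.

Lemma ln_Cmod_gamma0 (t : R) :
  ln (Cmod (gamma0 t)) = ln ((5 + 3 * cos t) / 32) / 2.
Proof.
  pose proof (Cmod_gamma0_bounds t).
  rewrite <- Cmod_gamma0_sqr. simpl. rewrite Rmult_1_r, ln_mult by lra. field.
Qed.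

Lemma gamma0_punctured (t : R) : punctured_disc (gamma0 t).
Proof. pose proof (Cmod_gamma0_bounds t). unfold punctured_disc. lra. Qed.

Lemma gamma0_curvature (t : R) :
  geodesic_curvature lambda gamma0 (cos t, sin t) t
  = curvature_density (cos t) / (lambda (gamma0 t) * (3 / 8)).
Proof.
  pose proof (gamma0_punctured t) as Hp. pose proof (lambda_pos _ Hp) as Hl.
  pose proof (sin2_cos2 t) as H. unfold Rsqr in H.
  destruct (gamma0 t) as [x y] eqn:E.
  assert (Hx := is_derive_lambda_comp (fun x => x) (fun _ => y) x 1 0
                  (is_derive_id x) (is_derive_const y x) Hp).
  assert (Hy := is_derive_lambda_comp (fun _ => x) (fun y => y) y 0 1
                  (is_derive_const x y) (is_derive_id y) Hp).
  simpl in Hx, Hy.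
  assert (Hv : dot (velocity gamma0 t) (velocity gamma0 t) = 9 / 64).
  { unfold gamma0. rewrite circle_velocity. unfold dot. simpl.
    transitivity (9 / 64 * (sin t * sin t + cos t * cos t));
      [field | rewrite H; field]. }
  erewrite (conformal_geodesic_curvature lambda gamma0 _ t).
  2: now rewrite E.
  2: { rewrite E. exact Hx. }
  2: { rewrite E. exact Hy. }
  2: { intros K. rewrite K in Hv. unfold dot in Hv. simpl in Hv. lra. }
  2: { unfold dot. simpl. lra. }
  2: { unfold gamma0. rewrite circle_velocity. unfold dot. simpl. ring. }
  assert (Ha := circle_acceleration (1 / 8) (3 / 8) t). fold gamma0 in Ha.
  rewrite Hv, Ha, E.
  pose proof (ln_Cmod_gamma0 t) as EL. pose proof (Cmod_gamma0_sqr t) as EQ.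
  rewrite E in EL, EQ.
  assert (Lneg : ln (Cmod (x, y)) < 0).
  { rewrite <- ln_1. destruct Hp. now apply ln_increasing. }
  destruct Hp as [Hp _].
  pose proof (COS_bound t) as Hc.
  unfold curvature_density.
  replace (ln ((5 + 3 * cos t) / 32)) with (2 * ln (Cmod (x, y))) by lra.
  injection E as Ex Ey. unfold dot. simpl.
  set (r := Cmod (x, y)) in *.
  replace ((9 + 3 * cos t) / (10 + 6 * cos t)) with ((9 + 3 * cos t) / 64 / r ^ 2)
    by (rewrite EQ; field; lra).
  replace ((9 + 3 * cos t) / 64) with (3 / 8 * (x * cos t + y * sin t)).
  2: { subst x y.
       transitivity
         (3 / 8 * (1 / 8 * cos t + 3 / 8 * (sin t * sin t + cos t * cos t)));
       [field | rewrite H; field]. }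
  replace (- (3 / 8) * cos t * cos t + - (3 / 8) * sin t * sin t) with (- (3 / 8)) by lra.
  unfold lambda. fold r. field. lra.
Qed.

Lemma gamma0_integrand (t : R) :
  arclength_integrand lambda gamma0
    (fun t => geodesic_curvature lambda gamma0 (cos t, sin t) t) t
  = curvature_density (cos t).
Proof.
  unfold arclength_integrand. rewrite gamma0_curvature.
  pose proof (lambda_pos _ (gamma0_punctured t)) as Hl.
  replace (metric_norm lambda (gamma0 t) (velocity gamma0 t))
    with (lambda (gamma0 t) * (3 / 8)).
  { field. lra. }
  unfold metric_norm. rewrite <- (sqrt_pow2 (lambda (gamma0 t) * (3 / 8))) by lra.
  f_equal. unfold inner, sum_axis, metric, gamma0. rewrite circle_velocity. simpl.
  pose proof (sin2_cos2 t) as H. unfold Rsqr in H.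
  set (l := lambda _).
  transitivity (l ^ 2 * (9 / 64) * (sin t * sin t + cos t * cos t));
    [rewrite H |]; field.
Qed.

(** * The maximum of lambda on the circle *)

Lemma ln_le_pred (y : R) : 0 < y -> ln y <= y - 1.
Proof.
  intros Hy. pose proof (exp_ineq1_le (ln y)) as H.
  rewrite exp_ln in H by easy. lra.
Qed.

(** Jensen's inequality for the concave function [ln] on [[1, 2]], from its
    tangent at [1 + s] evaluated at 1 and at 2. *)
Lemma ln_chord (s : R) : 0 <= s <= 1 -> s * ln 2 <= ln (1 + s).
Proof.
  intros Hs.
  pose proof (ln_le_pred (1 / (1 + s))) as A.
  pose proof (ln_le_pred (2 / (1 + s))) as B.
  rewrite ln_div, ln_1 in A by lra. rewrite ln_div in B by lra.
  specialize (A ltac:(apply Rdiv_lt_0_compat; lra)).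
  specialize (B ltac:(apply Rdiv_lt_0_compat; lra)).
  apply (Rmult_le_compat_l (1 - s)) in A; [| lra].
  apply (Rmult_le_compat_l s) in B; [| lra].
  assert (E : (1 - s) * (1 / (1 + s) - 1) + s * (2 / (1 + s) - 1) = 0)
    by (field; lra).
  lra.
Qed.

(** With [r = 1 / (2 (1 + s))] the claim is [(1 + s) ln 2 <= ln 2 + ln (1 + s)],
    that is, [ln_chord]; equality at [s = 0] and [s = 1] reflects that [lambda]
    takes the same value at both ends of the diameter. *)
Lemma lambda_le_inner (r : R) :
  1 / 4 <= r <= 1 / 2 -> - (1 / (r * ln r)) <= 2 / ln 2.
Proof.
  intros Hr. pose proof ln_lt_2 as L2.
  set (s := 1 / (2 * r) - 1).
  assert (Hs : 0 <= s <= 1).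
  { unfold s. split.
    - enough (1 <= 1 / (2 * r)) by lra. apply Rle_div_r; lra.
    - enough (1 / (2 * r) <= 2) by lra. apply Rle_div_l; lra. }
  assert (Hc : s * ln 2 <= ln (1 + s)) by now apply ln_chord.
  assert (Hl : ln 2 / 2 <= r * - ln r).
  { assert (E : ln (1 + s) = - ln 2 - ln r).
    { replace (1 + s) with (/ (2 * r)) by (unfold s; field; lra).
      rewrite ln_Rinv, ln_mult by lra. ring. }
    apply Rle_trans with (r * (ln 2 * (1 + s))).
    - right. unfold s. field. lra.
    - apply Rmult_le_compat_l; lra. }
  replace (- (1 / (r * ln r))) with (/ (r * - ln r)) by (field; split; nra).
  replace (2 / ln 2) with (/ (ln 2 / 2)) by (field; lra).
  apply Rinv_le_contravar; lra.
Qed.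

Lemma gamma0_PI : gamma0 PI = (- (1 / 4), 0).
Proof. unfold gamma0, circle. rewrite cos_PI, sin_PI. f_equal; field. Qed.

Lemma Cmod_gamma0_PI : Cmod (gamma0 PI) = 1 / 4.
Proof.
  rewrite <- (sqrt_pow2 (Cmod _)) by apply Cmod_ge_0.
  rewrite Cmod_gamma0_sqr, cos_PI.
  replace ((5 + 3 * -1) / 32) with ((1 / 4) ^ 2) by field.
  apply sqrt_pow2. lra.
Qed.

Lemma ln_quarter : ln (1 / 4) = - 2 * ln 2.
Proof.
  replace (1 / 4) with (/ (2 * 2)) by field.
  rewrite ln_Rinv, ln_mult by lra. ring.
Qed.

Theorem theorem2p9p3 :
  exists (gamma : R -> C) (T : R) (V : C -> Prop) (n : R -> C),
    simple_closed_smooth gamma T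
    /\ (forall t : R, punctured_disc (gamma t))
    /\ planar_domain V
    /\ (forall z : C, V z -> unit_disc z)
    /\ V (RtoC 0)
    /\ bounds gamma V
    /\ (forall t : R, outward_normal V gamma t (n t))
    /\ (forall t : R, 0 < geodesic_curvature lambda gamma (n t) t)
    /\ (let kappa_ds := arclength_integrand lambda gamma
                          (fun t => geodesic_curvature lambda gamma (n t) t) in
        ex_RInt kappa_ds 0 T /\ RInt kappa_ds 0 T > 2 * PI)
    /\ (exists tmax : R,
          (forall t : R, lambda (gamma t) <= lambda (gamma tmax))
          /\ normal_derivative lambda (gamma tmax) (n tmax) < 0).
Proof.
  exists gamma0, (2 * PI), (open_disc (1 / 8) (3 / 8)), (fun t => (cos t, sin t)).
  repeat match goal with |- _ /\ _ => split end.
  - apply circle_simple_closed_smooth. lra.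
  - apply gamma0_punctured.
  - apply disc_planar_domain. lra.
  - intros [x y]. unfold open_disc, unit_disc, Cmod. simpl. intros Hz.
    assert (x < 1 / 2) by nra. apply Rlt_le_trans with (sqrt 1).
    + apply sqrt_lt_1_alt. split; [apply Rplus_le_le_0_compat |]; nra.
    + rewrite sqrt_1. lra.
  - unfold open_disc, RtoC. simpl. lra.
  - apply circle_bounds_disc. lra.
  - intros t. apply circle_outward_normal. lra.
  - intros t. rewrite gamma0_curvature.
    pose proof (COS_bound t) as Hc.
    pose proof (minorant_pos _ Hc). pose proof (minorant_le _ Hc).
    pose proof (lambda_pos _ (gamma0_punctured t)).
    apply Rdiv_lt_0_compat; lra.
  - cbv zeta. destruct curvature_density_integral as [He Hi]. split.
    + apply (ex_RInt_ext (fun t => curvature_density (cos t))); [| easy].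
      intros t _. symmetry. apply gamma0_integrand.
    + rewrite (RInt_ext _ (fun t => curvature_density (cos t))); [easy |].
      intros t _. apply gamma0_integrand.
  - pose proof ln_lt_2 as L2. exists PI. split.
    + intros t. apply Rle_trans with (2 / ln 2).
      * apply lambda_le_inner, Cmod_gamma0_bounds.
      * right. unfold lambda. rewrite Cmod_gamma0_PI, ln_quarter. field. lra.
    + pose proof (gamma0_punctured PI) as Hp.
      pose proof (lambda_pos _ Hp) as Hl.
      pose proof Cmod_gamma0_PI as Er.
      rewrite gamma0_PI in *. rewrite cos_PI, sin_PI.
      unfold normal_derivative.
      rewrite (Derive_ext _ (fun s => lambda (- (1 / 4) - s, 0))).
      2: { intros s. f_equal. unfold RtoC, Cplus, Cmult. simpl. f_equal; ring. }
      replace (- (1 / 4), 0) with (- (1 / 4) - 0, 0) in * by (f_equal; ring).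
      assert (Hd : is_derive (fun s => - (1 / 4) - s) 0 (- 1))
        by (auto_derive; [easy | ring]).
      assert (D := is_derive_lambda_comp _ (fun _ => 0) 0 (- 1) 0 Hd
                     (is_derive_const 0 0) Hp).
      eapply Rle_lt_trans; [right; exact (is_derive_unique _ _ _ D) |]. cbv beta.
      rewrite Er, ln_quarter.
      set (l := lambda _) in *.
      replace (l ^ 2 * (1 + -2 * ln 2)
        * ((- (1 / 4) - 0) * -1 + 0 * 0) / (1 / 4))
        with (- (l ^ 2 * (2 * ln 2 - 1))) by field.
      enough (0 < l ^ 2 * (2 * ln 2 - 1)) by lra.
      apply Rmult_lt_0_compat; nra.
Qed.
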